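(* A bipartite graph $G$ has a d-convex $2$-partition if and only if $G$ has diameter at least $3$. Moreover, if such a partition exists, it can be found in polynomial time (i.e., there is a polynomial-time algorithm that, given a bipartite graph $G$ having a d-convex $2$-partition, outputs one).
   Context: Graphs are finite, undirected, without loops or multiple edges. For a vertex $v$, $N_G(v)$ is the set of neighbors of $v$ and $N_G[v]=N_G(v)\cup\{v\}$; for $S\subseteq V(G)$, $N_G(S)$ is the set of vertices having at least one neighbor in $S$, and $N_G[S]=N_G(S)\cup S$. A set $S\subseteq V(G)$ is d-convex (digitally convex) if for every vertex $v$ of $G$, $N_G[v]\subseteq N_G[S]$ implies $v\in S$. A d-convex $2$-partition of $G$ is a pair of disjoint d-convex sets $V_1,V_2$, each different from $V(G)$, with $V_1\cup V_2=V(G)$. The distance between two vertices is the minimum number of edges of a path joining them (infinite if there is no such path), and the diameter of $G$ is the maximum distance between two of its vertices; in particular a disconnected graph has infinite diameter, which counts as at least $3$. *)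

(* Defs.v *)
From mathcomp Require Import all_boot.
Set Implicit Arguments.
Unset Strict Implicit.
Unset Printing Implicit Defensive.

Record sgraph := SGraph {
  vertex :> finType;
  edge : rel vertex;
  edge_sym : symmetric edge;
  edge_irr : irreflexive edge }.

Section Graph.
Variable G : sgraph.
Implicit Types (x y v : G) (S : {set G}).

Definition bipartite : Prop :=
  exists A : {set G}, forall x y, edge x y -> (x \in A) != (y \in A).

Definition nbhd v : {set G} := [set u | edge v u].
Definition cnbhd v : {set G} := nbhd v :|: [set v].
Definition set_nbhd S : {set G} := [set u | [exists v in S, edge u v]].
Definition set_cnbhd S : {set G} := set_nbhd S :|: S.

Definition dconvex S : Prop :=
  forall v, cnbhd v \subset set_cnbhd S -> v \in S.

Definition dconvex_2partition (V1 V2 : {set G}) : Prop :=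
  [/\ [disjoint V1 & V2], dconvex V1 /\ dconvex V2,
      V1 <> [set: G] /\ V2 <> [set: G] & V1 :|: V2 = [set: G]].

Definition has_path x y (k : nat) : bool :=
  [exists p : k.-tuple G,
     [&& path (@edge G) x p, uniq (x :: p) & last x p == y]].

(* Distances and diameters live in [option nat], where [None] is infinity.
   A path has fewer than #|G| edges, so searching the lengths 0, ..., #|G| - 1
   is exhaustive. *)
Definition dist x y : option nat :=
  let k := find (has_path x y) (iota 0 #|G|) in
  if k < #|G| then Some k else None.

Definition diameter : option nat :=
  if [forall x : G, forall y : G, dist x y != None]
  then Some (\max_(x : G) \max_(y : G) odflt 0 (dist x y))
  else None.

End Graph.

Definition at_least (m : nat) (d : option nat) : bool :=
  if d is Some k then m <= k else true.

(* Polynomial time is measured on a random access machine with unit-cost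
   instructions (Cook and Reckhow).  The only arithmetic is addition and
   truncated subtraction, so a register has bit length at most linear in the
   running time, and the machine is polynomially equivalent to Turing
   machines. *)
Inductive instr :=
  | Const of nat & nat
  | Add of nat & nat & nat
  | Sub of nat & nat & nat
  | Peek of nat & nat
  | Poke of nat & nat
  | Input of nat & nat
  | Output of nat
  | Jz of nat & nat
  | Halt.

Definition program := seq instr.

Record config := Config { pc : nat; reg : nat -> nat; out : seq bool }.

Definition upd (r : nat -> nat) (d a : nat) : nat -> nat :=
  fun i => if i == d then a else r i.

(* The program also halts when its counter leaves the program. *)
Definition fetch (p : program) (c : config) : instr := nth Halt p (pc c).

Definition halted (p : program) (c : config) : bool :=
  if fetch p c is Halt then true else false.

Definition step (p : program) (w : seq bool) (c : config) : config :=
  let: Config i r o := c in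
  match fetch p c with
  | Const d a => Config i.+1 (upd r d a) o
  | Add d s t => Config i.+1 (upd r d (r s + r t)) o
  | Sub d s t => Config i.+1 (upd r d (r s - r t)) o
  | Peek d s => Config i.+1 (upd r d (r (r s))) o
  | Poke d s => Config i.+1 (upd r (r d) (r s)) o
  | Input d s => Config i.+1 (upd r d (nth false w (r s))) o
  | Output s => Config i.+1 r (rcons o (r s != 0))
  | Jz s l => Config (if r s == 0 then l else i.+1) r o
  | Halt => c
  end.

Definition init : config := Config 0 (fun _ => 0) [::].

(* Halted configurations are fixed by [step], so the bound [t] on the number of
   steps need not be attained. *)
Definition outputs_within (p : program) (w : seq bool) (t : nat)
    (o : seq bool) : Prop :=
  let c := iter t (step p w) init in halted p c /\ out c = o.

(* The number of vertices in unary, then the adjacency matrix row by row. *)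
Definition encode_graph (G : sgraph) : seq bool :=
  nseq #|G| true ++ false :: [seq edge x y | x <- enum G, y <- enum G].

Definition encode_set (G : sgraph) (S : {set G}) : seq bool :=
  [seq x \in S | x <- enum G].

Definition encode_pair (G : sgraph) (V1 V2 : {set G}) : seq bool :=
  encode_set V1 ++ encode_set V2.

(* [P] is a promise on the input graph, [sol G] the set of valid answers. *)
Definition poly_time_search (P : sgraph -> Prop)
    (sol : forall G : sgraph, {set G} -> {set G} -> Prop) : Prop :=
  exists (p : program) (a k : nat), forall G : sgraph, P G ->
    exists V1 V2 : {set G}, sol G V1 V2 /\
      outputs_within p (encode_graph G)
        (a * size (encode_graph G) ^ k + a) (encode_pair V1 V2).

(* Main.v *)
Require Import Defs.
From mathcomp Require Import all_boot zify.

Set Implicit Arguments.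
Unset Strict Implicit.
Unset Printing Implicit Defensive.

(** For a vertex [a] of a bipartite graph let V1 consist of N[a] and of all
    non-isolated v with N(v) included in N(a).  A set is d-convex exactly when
    its complement is a union of closed neighbourhoods, and both V1 and its
    complement are such unions.  Hence they form a d-convex 2-partition as soon
    as V1 is not everything, and every vertex at distance at least 3 from [a]
    is outside V1.  Conversely, the two
    parts of a d-convex 2-partition each contain a closed neighbourhood, and the
    centres of these are at distance at least 3.  The algorithm computes V1 for
    each [a] in turn and stops at the first one for which V1 is not everything;
    it never needs the bipartition. *)

(** * Digital convexity through closed neighbourhoods *)

Section Graph.
Variable G : sgraph.
Implicit Types (x y u v c : G) (S : {set G}).

Lemma in_cnbhd u v : (u \in cnbhd v) = edge v u || (u == v).
Proof. by rewrite !inE. Qed.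

Lemma in_set_cnbhd S u : (u \in set_cnbhd S) = ~~ [disjoint cnbhd u & S].
Proof.
rewrite !inE; apply/idP/idP.
  case/orP=> [/existsP[v /andP[vS uv]]|uS]; apply/pred0Pn.
    by exists v; rewrite /= in_cnbhd uv vS.
  by exists u; rewrite /= in_cnbhd eqxx orbT uS.
case/pred0Pn=> v /= /andP[]; rewrite in_cnbhd => /orP[uv|/eqP->] vS.
  by apply/orP; left; apply/existsP; exists v; rewrite vS.
by rewrite vS orbT.
Qed.

(** Contrapositive of the definition: that [N[v]] is not inside [N[S]] is witnessed by some [u] in
    [N[v]] whose own closed neighbourhood misses [S]. *)
Lemma dconvexP S :
  dconvex S <->
  forall v, v \notin S -> exists2 u, u \in cnbhd v & [disjoint cnbhd u & S].
Proof.
split=> cS v.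
  move=> vS; have /subsetPn[u vu] : ~~ (cnbhd v \subset set_cnbhd S).
    by apply: contra vS => /cS.
  by rewrite in_set_cnbhd negbK; exists u.
move=> /subsetP sub; apply: contraT => /cS[u /sub].
by rewrite in_set_cnbhd => /negP.
Qed.

Lemma dconvex_2partition_setC S :
    S != set0 -> ~: S != set0 -> dconvex (~: S) -> dconvex S ->
  dconvex_2partition S (~: S).
Proof.
move=> S0 S'0 cS' cS.
split; rewrite ?setUCr -?setI_eq0 ?setICr //.
split=> // ST; last by move: S0; rewrite -[S]setCK ST setCT eqxx.
by move: S'0; rewrite ST setCT eqxx.
Qed.

(** * Short paths, distance and diameter *)

Lemma has_path0 x y : has_path x y 0 = (x == y).
Proof.
apply/existsP/idP=> [[p]|xy]; first by rewrite (tuple0 p) => /and3P[].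
by exists [tuple]; rewrite /= xy.
Qed.

Lemma has_path1 x y : has_path x y 1 = edge x y.
Proof.
apply/existsP/idP=> [[p]|xy].
  case/tupleP: p => z p; rewrite (tuple0 p) /= => /and3P[/andP[xz _] _ /eqP<-].
  by [].
exists [tuple y]; rewrite /= xy eqxx inE !andbT.
by apply: contraTneq xy => ->; rewrite edge_irr.
Qed.

Lemma has_path2 x y :
  has_path x y 2 = (x != y) && [exists c, edge x c && edge c y].
Proof.
apply/existsP/idP=> [[p]|/andP[xy /existsP[c /andP[xc cy]]]].
  case/tupleP: p => c p; case/tupleP: p => z p.
  rewrite (tuple0 p) /= => /and3P[/and3P[xc cz _] + /eqP zy].
  rewrite !inE negb_or zy -andbA => /and3P[_ -> _] /=.
  by apply/existsP; exists c; rewrite xc -zy.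
exists [tuple c; y]; rewrite /= xc cy eqxx !inE negb_or xy !andbT /=.
by apply/andP; split; [apply: contraTneq xc|apply: contraTneq cy] => ->;
  rewrite edge_irr.
Qed.

Lemma has_path_card x y k : has_path x y k -> k < #|G|.
Proof.
case/existsP=> p /and3P[_ /card_uniqP + _]; rewrite /= size_tuple => <-.
exact: max_card.
Qed.

(** A common element [c] gives a walk from [x] through [c] to [y]; coincidences among the three
    account for the shorter paths. *)
Lemma meet_cnbhd x y :
  ~~ [disjoint cnbhd x & cnbhd y] =
  [|| has_path x y 0, has_path x y 1 | has_path x y 2].
Proof.
rewrite has_path0 has_path1 has_path2; apply/pred0Pn/or3P.
  case=> c /=; rewrite !in_cnbhd.
  case: (eqVneq x y) => [|xy]; first by constructor 1.
  case: (eqVneq c x) => [->|cx]; rewrite ?orbT ?orbF /=.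
    by rewrite (negPf xy) orbF edge_sym; constructor 2.
  case: (eqVneq c y) => [->|cy]; rewrite ?orbT ?orbF ?andbT.
    by constructor 2.
  by rewrite (edge_sym y) => xcy; constructor 3; apply/existsP; exists c.
case=> [/eqP->|xy|/andP[_ /existsP[c /andP[xc cy]]]].
- by exists y; rewrite /= !in_cnbhd eqxx orbT.
- by exists y; rewrite /= !in_cnbhd xy eqxx orbT.
- by exists c; rewrite /= !in_cnbhd xc edge_sym cy.
Qed.

(** The default 3 stands for infinity; it only has to exceed 2. *)
Lemma dist_le2 x y :
  (odflt 3 (dist x y) <= 2) = ~~ [disjoint cnbhd x & cnbhd y].
Proof.
rewrite meet_cnbhd /dist; set f := find _ _.
have path_f k : has_path x y k -> f <= k.
  move=> pk; rewrite leqNgt; apply/negP => kf.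
  have := before_find 0 kf; rewrite nth_iota ?pk //.
  exact: has_path_card pk.
apply/idP/or3P => [|pk].
  case: ifP => // ltf /= f2.
  have : has_path x y f.
    have hf : has (has_path x y) (iota 0 #|G|) by rewrite has_find size_iota.
    by have := nth_find 0 hf; rewrite -/f nth_iota.
  by case: f f2 {ltf path_f} => [|[|[|//]]] _; constructor.
have [k k2 pk'] : exists2 k, k <= 2 & has_path x y k.
  by case: pk; [exists 0|exists 1|exists 2].
rewrite (leq_ltn_trans (path_f _ pk') (has_path_card pk')) /=.
exact: leq_trans (path_f _ pk') k2.
Qed.

Lemma diameter_ge3 :
  at_least 3 (diameter G) <-> exists x y, [disjoint cnbhd x & cnbhd y].
Proof.
rewrite /diameter; split=> [|[x [y dxy]]].
  case: ifP => [/forallP fin /= ge3|/negbT/forallPn[x /forallPn[y]]];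
    last first.
    rewrite negbK => /eqP dxy _; exists x, y.
    by rewrite -[[disjoint _ & _]]negbK -dist_le2 dxy.
  have [/existsP[x /existsP[y dxy]]|far] :=
    boolP [exists x : G, exists y : G, [disjoint cnbhd x & cnbhd y]].
    by exists x, y.
  move: ge3; rewrite ltnNge => /negP[].
  apply/bigmax_leqP => x _; apply/bigmax_leqP => y _.
  have := forallP (fin x) y; have := dist_le2 x y.
  case: (dist x y) => //= k -> _; apply: contra far => dxy.
  by apply/existsP; exists x; apply/existsP; exists y.
case: ifP => [/forallP fin|//] /=.
apply: leq_trans (leq_bigmax x); apply: leq_trans (leq_bigmax y).
have := forallP (fin x) y; have := dist_le2 x y.
by rewrite dxy; case: (dist x y) => //= k; rewrite leqNgt => /negbFE.
Qed.

(** * Partitions and pairs of disjoint closed neighbourhoods *)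

Lemma dconvex_2partition_disjoint (V1 V2 : {set G}) :
  dconvex_2partition V1 V2 -> exists x y, [disjoint cnbhd x & cnbhd y].
Proof.
case=> dV [cV1 cV2] [/eqP V1T /eqP V2T] UV.
have inV v : (v \in V1) || (v \in V2) by rewrite -in_setU UV.
(* A proper d-convex set misses a whole closed neighbourhood, which the other part must then
   contain. *)
have block (V W : {set G}) : dconvex V -> V != [set: G] ->
    (forall v, (v \in V) || (v \in W)) -> exists x, cnbhd x \subset W.
  move=> /dconvexP cV VT VW.
  have /existsP[v /cV[u _ duV]] : [exists v, v \notin V].
    by rewrite -negb_forall; apply: contra VT => /forallP allV;
      apply/eqP/setP => v; rewrite allV inE.
  exists u; apply/subsetP => c uc; have := VW c.
  by rewrite (disjointFr duV uc).
have [x xV1] := block _ _ cV2 V2T (fun v => etrans (orbC _ _) (inV v)).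
have [y yV2] := block _ _ cV1 V1T inV.
by exists x, y; apply: disjointWl xV1 _; apply: disjointWr yV2 dV.
Qed.

(* Isolated vertices other than [a] are kept out: otherwise the complement could
   be empty, for instance in an edgeless graph. *)
Definition dom_set (a : G) : {set G} :=
  [set v | [|| edge v a, v == a
    | [forall c, edge v c ==> edge a c] && [exists c, edge v c && edge a c]]].

Lemma dom_set_id a : a \in dom_set a.
Proof. by rewrite inE eqxx orbT. Qed.

Lemma dom_setPn a b : [disjoint cnbhd a & cnbhd b] -> b \notin dom_set a.
Proof.
apply: contraL; rewrite inE => ab; apply/pred0Pn.
case/or3P: ab => [ba|/eqP->|/andP[_ /existsP[c /andP[bc ac]]]].
- by exists b; rewrite /= !in_cnbhd eqxx edge_sym ba orbT.
- by exists a; rewrite /= in_cnbhd eqxx orbT.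
- by exists c; rewrite /= !in_cnbhd bc ac.
Qed.

Lemma dom_set_partition a b : bipartite G -> b \notin dom_set a ->
  dconvex_2partition (dom_set a) (~: dom_set a).
Proof.
case=> A bip bS; apply: dconvex_2partition_setC.
- by apply/set0Pn; exists a; exact: dom_set_id.
- by apply/set0Pn; exists b; rewrite in_setC.
- apply/dconvexP => v; rewrite in_setC negbK => vS.
  (* Take [u = a] for [a] and its neighbours, and [u = v] for every other [v], whose neighbours all
     lie in [N(a)]. *)
  suff [u vu uS] : exists2 u, u \in cnbhd v & cnbhd u \subset dom_set a.
    by exists u => //; rewrite disjoint_sym disjoints_subset setCS.
  have aS : cnbhd a \subset dom_set a.
    apply/subsetP => u; rewrite in_cnbhd => /orP[au|/eqP->];
      last exact: dom_set_id.
    by rewrite inE edge_sym au.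
  move: vS; rewrite inE => /or3P[va|/eqP->|/andP[/forallP va vc]].
  + by exists a; rewrite // in_cnbhd va.
  + by exists a; rewrite // in_cnbhd eqxx orbT.
  exists v; first by rewrite in_cnbhd eqxx orbT.
  apply/subsetP=> u; rewrite in_cnbhd => /orP[vu|/eqP->].
    by rewrite inE edge_sym (implyP (va u) vu).
  by rewrite inE vc andbT; apply/or3P; constructor 3; apply/forallP.
(* The neighbour [y] of [c] outside [N(a)] rules out both [c = a] and the inclusion of [N(c)] in
   [N(a)]. *)
have far y c : ~~ edge a y -> edge y c -> ~~ edge c a -> c \notin dom_set a.
  move=> ay yc ca; rewrite inE (negPf ca) /= negb_or; apply/andP; split.
    by apply: contraNneq ay => <-; rewrite edge_sym.
  rewrite negb_and; apply/orP; left; apply/forallPn; exists y.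
  by rewrite edge_sym yc.
apply/dconvexP => v vS.
have : v \notin dom_set a by [].
rewrite inE 2!negb_or => /and3P[va v_a].
have vv : v \in cnbhd v by rewrite in_cnbhd eqxx orbT.
(* Either [v] has a neighbour [y] outside [N(a)], and then [v] or [y] is the required centre, or [v]
   has no neighbour in [N(a)], and [v] is. *)
rewrite negb_and => /orP[/forallPn[y]|novc].
  rewrite negb_imply => /andP[vy ay].
  have [u_S|] := boolP (cnbhd v :&: dom_set a == set0).
    by exists v; rewrite // -setI_eq0.
  case/set0Pn => c /setIP[]; rewrite in_cnbhd => /orP[vc cS|/eqP-> vS'];
    last first.
    by rewrite vS' in vS.
  (* [v] has a neighbour in [dom_set a], hence lies on the side of [a] *)
  have side : (v \in A) = (a \in A).
    move: cS; rewrite inE => /or3P[ca|/eqP ca|/andP[/forallP cc _]].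
    - by have := bip _ _ vc; have := bip _ _ ca; do 3 case: (_ \in A).
    - by rewrite -ca vc in va.
    - by have := implyP (cc v);
        rewrite [edge c v]edge_sym vc [edge a v]edge_sym (negPf va) => /(_ isT).
  (* Now [y] is on the side opposite to [a], so the neighbours of [y] are on the side of [a], hence
     not adjacent to [a], and [far] excludes them. *)
  exists y; first by rewrite in_cnbhd vy.
  rewrite -setI_eq0 -subset0; apply/subsetP => d /setIP[]; rewrite in_cnbhd.
  case/orP=> [yd dS|/eqP-> yS].
    suff : d \notin dom_set a by rewrite dS.
    apply: (far y) => //; apply/negP => da.
    have := bip _ _ vy; have := bip _ _ yd; have := bip _ _ da.
    by rewrite -side; do 3 case: (_ \in A).
  move: yS; rewrite inE => /or3P[|/eqP ya|/andP[/forallP yc _]].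
  - by rewrite edge_sym (negPf ay).
  - by rewrite -ya vy in va.
  - by have := implyP (yc v);
      rewrite [edge y v]edge_sym vy [edge a v]edge_sym (negPf va) => /(_ isT).
exists v => //; rewrite -setI_eq0 -subset0; apply/subsetP => c /setIP[].
rewrite in_cnbhd => /orP[vc cS|/eqP-> vS']; last by rewrite vS' in vS.
have : c \notin dom_set a by apply: (far v); rewrite // ?[edge a v]edge_sym //;
  apply: contra novc => ca; apply/existsP; exists c; rewrite vc edge_sym.
by rewrite cS.
Qed.

Lemma dconvex_2partition_diameter : bipartite G ->
  (exists V1 V2 : {set G}, dconvex_2partition V1 V2)
    <-> at_least 3 (diameter G).
Proof.
move=> bip; split=> [[V1 [V2 /dconvex_2partition_disjoint]]|].
  by move=> ?; apply/diameter_ge3.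
case/diameter_ge3=> a [b /dom_setPn bS].
by exists (dom_set a), (~: dom_set a); apply: dom_set_partition bS.
Qed.

End Graph.

Local Notation Sub := Defs.Sub.

(** * Reasoning about runs with a bounded number of steps *)

Section Runs.
Variables (p : program) (w : seq bool).
Implicit Types (c : config) (P Q : config -> Prop).

Definition within t c P := exists2 k, k <= t & P (iter k (step p w) c).

Lemma within_run t c P : P (iter t (step p w) c) -> within t c P.
Proof. by exists t. Qed.

Lemma within_bind t1 t2 c P Q :
    within t1 c Q -> (forall c', Q c' -> within t2 c' P) ->
  within (t1 + t2) c P.
Proof.
move=> [k1 k1t Qc] /(_ _ Qc)[k2 k2t Pc].
by exists (k2 + k1); [rewrite addnC leq_add|rewrite iterD].
Qed.

Lemma within_step t c P : within t (step p w c) P -> within t.+1 c P.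
Proof. by case=> k kt Pk; exists k.+1 => //; rewrite iterSr. Qed.

Lemma within_after k t c P :
  within t (iter k (step p w) c) P -> within (k + t) c P.
Proof.
move=> tP; apply: (@within_bind k t c P (eq (iter k (step p w) c))).
  exact: within_run.
by move=> _ <-.
Qed.

Lemma within_sub t c P Q :
  (forall c', Q c' -> P c') -> within t c Q -> within t c P.
Proof. by move=> QP [k kt /QP]; exists k. Qed.

Lemma within_leq t1 t2 c P : t1 <= t2 -> within t1 c P -> within t2 c P.
Proof. by move=> le_t [k kt Pc]; exists k => //; apply: leq_trans le_t. Qed.

(** [I i] describes the state after [i] rounds. The invariants below let the program counter depend
    on [i], so that [I n] is the exit state. *)
Lemma within_loop (I : nat -> config -> Prop) n t c :
    I 0 c -> (forall i c', i < n -> I i c' -> within t c' (I i.+1)) ->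
  within (n * t) c (I n).
Proof.
move=> I0; elim: n => [|n IHn] Istep; first exact: within_run.
rewrite mulSnr; apply: (@within_bind _ _ _ _ (I n)).
  by apply: IHn => i c' lt_in; apply: Istep; apply: ltnW.
by move=> c'; apply: Istep.
Qed.

End Runs.

(* Register 0 holds the number n of vertices, 1 the constant 1, 2 the candidate
   [a], 5 and 7 the vertices [v] and [c], 3 and 6 the addresses of rows [a] and
   [v] in the input, 4 the number of [v] outside [dom_set a], 8 the number of
   neighbours [c] of [v] not adjacent to [a], 9 the number of those adjacent to
   [a]; 10 to 14 are temporaries.  The characteristic vectors of [dom_set a] and
   of its complement are stored in registers 16, ..., 16 + 2n - 1. *)
Definition search_prog : program := [::
(*  0 *) Const 1 1;
(*  1 *) Add 0 0 1; Input 10 0; Sub 10 1 10; Jz 10 1;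
(*  5 *) Add 3 0 1;
(*  6 *) Const 4 0; Const 5 0; Add 6 0 1;
(*  9 *) Const 7 0; Const 8 0; Const 9 0;
(* 12 *) Add 10 6 7; Input 10 10; Add 11 3 7; Input 11 11;
(* 16 *) Sub 11 10 11; Add 8 8 11; Sub 11 10 11; Add 9 9 11;
(* 20 *) Add 7 7 1; Sub 10 0 7; Sub 10 1 10; Jz 10 12;
(* 24 *) Add 10 6 2; Input 10 10; Sub 11 5 2; Sub 12 2 5;
(* 28 *) Add 11 11 12; Sub 11 1 11; Add 10 10 11; Sub 11 1 8;
(* 32 *) Sub 12 1 9; Sub 11 11 12; Add 10 10 11; Sub 11 1 10;
(* 36 *) Add 4 4 11; Const 12 16; Add 12 12 5; Add 14 12 0;
(* 40 *) Add 5 5 1; Add 6 6 0; Sub 13 0 5; Sub 13 1 13;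
(* 44 *) Poke 12 10; Poke 14 11; Jz 13 9;
(* 47 *) Add 2 2 1; Add 3 3 0; Jz 4 6;
(* 50 *) Add 3 0 0; Const 5 0; Const 12 16;
(* 53 *) Peek 10 12; Output 10; Add 12 12 1; Add 5 5 1;
(* 57 *) Sub 10 3 5; Sub 10 1 10; Jz 10 53;
(* 60 *) Halt].

(* Normalizing after each step keeps the register file small, whereas
   evaluating [iter] at once is exponential. *)
Ltac run_step := apply: within_step;
  match goal with |- within _ _ _ ?c _ =>
    let c' := eval cbn -[addn subn muln] in c in change c with c' end.

(** * Correctness and running time of the program, on vertex indices *)

Section Search.
Variables (w : seq bool) (n : nat) (e : rel nat).
Hypothesis n_gt0 : 0 < n.
Hypothesis w_unary : forall i, i <= n -> nth false w i = (i < n).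
Hypothesis w_edge :
  forall i j, i < n -> j < n -> nth false w (n.+1 + n * i + j) = e i j.

Let run := within search_prog w.

(** Membership of [v] in [dom_set a], transported to vertex indices. *)
Definition dominated a v :=
  [|| e v a, v == a
    | [forall c : 'I_n, e v c ==> e a c] && [exists c : 'I_n, e v c && e a c]].

(** Truncated subtraction decides [i < m], so a single [Jz] closes a counted loop. *)
Lemma back_jump (m i l l' : nat) :
  (if 1 - (m - i) == 0 then l else l') = if i < m then l else l'.
Proof. by rewrite -[i < m]subn_gt0; case: (m - i) => [|k]. Qed.

Lemma run_size o r :
    r 0 = 0 -> r 2 = 0 ->
  run (1 + n * 4) (Config 0 r o) (fun c =>
    [/\ pc c = 5, out c = o, reg c 0 = n, reg c 1 = 1 & reg c 2 = 0]).
Proof.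
move=> r0 r2; apply: within_after.
pose I i c := [/\ pc c = if i < n then 1 else 5, out c = o,
  reg c 0 = i, reg c 1 = 1 & reg c 2 = 0].
apply: (@within_sub _ _ _ _ _ (I n)).
  by move=> c [pcn ? ? ? ?]; split=> //; rewrite pcn ltnn.
apply: within_loop => [|i [_ r' _] lt_in [/= -> -> r'0 r'1 r'2]].
  by rewrite /I /= n_gt0.
rewrite lt_in; apply: within_run.
(* The bit is read after the increment, so the loop stops at the separator, at position [n]. *)
rewrite /I /= /upd /= r'0 r'1 r'2 addn1 w_unary //.
by split => //; case: (_ < _).
Qed.

(** The summands are the indicators of [N(v)] minus [N(a)] and of the common neighbours, both
    obtained by truncated subtraction. *)
Lemma run_row a v r o :
    a < n -> v < n -> r 0 = n -> r 1 = 1 ->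
    r 3 = n.+1 + n * a -> r 6 = n.+1 + n * v ->
  run (3 + n * 12) (Config 9 r o) (fun c =>
    [/\ pc c = 24, out c = o,
      reg c 8 = \sum_(j < n) (e v j - e a j),
      reg c 9 = \sum_(j < n) (e v j - (e v j - e a j))
    & forall i, (i < 7) || (11 < i) -> reg c i = r i]).
Proof.
move=> an vn r0 r1 r3 r6; apply: within_after.
pose I j c := [/\ pc c = if j < n then 12 else 24, out c = o /\ reg c 7 = j,
  reg c 8 = \sum_(k < j) (e v k - e a k),
  reg c 9 = \sum_(k < j) (e v k - (e v k - e a k))
  & forall i, (i < 7) || (11 < i) -> reg c i = r i].
apply: (@within_sub _ _ _ _ _ (I n)).
  by move=> c [pcn [? _] ? ? ?]; split=> //; rewrite pcn ltnn.
apply: within_loop => [|j c jn].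
  rewrite /I /= n_gt0 !big_ord0; do !split=> //.
  by do 12?[case=> //].
case: c => pc r' o' [/= -> [-> r'7] r'8 r'9 fr]; rewrite jn.
do 12 run_step; apply: (@within_run _ _ 0).
rewrite /= r'7 r'8 r'9 !fr // r0 r1 r3 r6 !w_edge // addn1.
split; rewrite ?big_ord_recr //=; first exact: back_jump.
by move=> i; do 12?[case: i => [|i] //]; apply: fr.
Qed.

(** The right-hand side is what register 10 computes: one summand per clause of [dominated], with
    equality tested by the absolute difference of [v] and [a]. *)
Lemma dominatedE a v : a < n -> v < n ->
  dominated a v =
  (e v a + (1 - (v - a + (a - v))) +
   (1 - \sum_(j < n) (e v j - e a j) -
    (1 - \sum_(j < n) (e v j - (e v j - e a j)))) != 0).
Proof.
move=> an vn; rewrite /dominated.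
have -> : [forall c : 'I_n, e v c ==> e a c] =
    (\sum_(j < n) (e v j - e a j) == 0).
  by rewrite sum_nat_eq0; apply: eq_forallb => c; do 2 case: (e _ _).
have -> : [exists c : 'I_n, e v c && e a c] =
    (\sum_(j < n) (e v j - (e v j - e a j)) != 0).
  rewrite sum_nat_eq0 negb_forall; apply: eq_existsb => c.
  by do 2 case: (e _ _).
have -> : (v == a) = (1 - (v - a + (a - v)) != 0) by lia.
by case: (e v a); case: (bigop _ _ _) => [|k]; case: (bigop _ _ _) => [|l] //=; lia.
Qed.

(** Entries are only compared with 0, as several clauses of [dominated] may hold at once and make
    register 10 exceed 1. *)
Definition stored (r : nat -> nat) a j := forall i, i < j ->
  (r (16 + i) != 0) = dominated a i /\ (r (16 + n + i) != 0) = ~~ dominated a i.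

(** The two [Poke] addresses are computed, and being at least 16 they leave the working registers
    intact. *)
Lemma run_store v r o : r 12 = 16 + v -> r 14 = 16 + (v + n) ->
  run 3 (Config 44 r o) (fun c =>
    [/\ pc c = if r 13 == 0 then 9 else 47, out c = o,
      forall i, i < 16 -> reg c i = r i
    & forall i, reg c (16 + i) =
        if i == v + n then r 11 else if i == v then r 10 else r (16 + i)]).
Proof.
move=> r12 r14.
have low i k : i < 16 -> (i == 16 + k) = false by lia.
do 3 apply: within_step; apply: (@within_run _ _ 0).
rewrite /= r12 [in upd r _ _ 14]/upd low // r14; split=> //=.
by move=> i i16; rewrite /upd !low.
Qed.

Lemma run_candidate a r o :
    a < n -> r 0 = n -> r 1 = 1 -> r 2 = a -> r 3 = n.+1 + n * a ->
  run (3 + n * (26 + n * 12)) (Config 6 r o) (fun c =>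
    [/\ pc c = 47, out c = o,
      [/\ reg c 0 = n, reg c 1 = 1, reg c 2 = a & reg c 3 = n.+1 + n * a],
      reg c 4 = \sum_(v < n) ~~ dominated a v & stored (reg c) a n]).
Proof.
move=> an r0 r1 r2 r3; apply: within_after.
pose I j c := [/\ pc c = if j < n then 9 else 47, out c = o,
  [/\ reg c 0 = n, reg c 1 = 1, reg c 2 = a & reg c 3 = n.+1 + n * a],
  [/\ reg c 4 = \sum_(v < j) ~~ dominated a v, reg c 5 = j
    & reg c 6 = n.+1 + n * j] & stored (reg c) a j].
apply: (@within_sub _ _ _ _ _ (I n)).
  by move=> c [pcn ? ? [? _ _] ?]; split=> //; rewrite pcn ltnn.
apply: within_loop => [|v c vn].
  cbn -[addn subn muln I]; rewrite r0 r1.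
  by split=> //=; rewrite ?n_gt0 ?big_ord0 ?muln0 ?addn0 ?addn1.
case: c => pc r' o' [/= -> -> [r'0 r'1 r'2 r'3] [r'4 r'5 r'6] mem]; rewrite vn.
(* After the row loop come 20 arithmetic instructions and the 3 of [run_store]. *)
have -> : 26 + n * 12 = 3 + n * 12 + 23 by lia.
apply: within_bind (run_row _ an vn r'0 r'1 r'3 r'6) _ => {}c.
case: c => _ r2' _ [/= -> -> r2'8 r2'9 fr].
do 20 run_step.
rewrite r2'8 r2'9 !fr // r'0 r'1 r'2 r'4 r'5 r'6 !w_edge // addn1.
set m := e v a + _ + _; set u := upd _ _ _.
have mE : (m != 0) = dominated a v by rewrite dominatedE.
have u12 : u 12 = 16 + v by [].
have u14 : u 14 = 16 + (v + n) by rewrite addnA.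
apply: within_sub (run_store _ u12 u14) => c [pcE outE low high].
split=> //.
- by rewrite pcE; apply: back_jump.
- by split; rewrite low // /u /upd /= ?fr.
- split; rewrite low // /u /upd /= ?mulnS //; last by lia.
  by rewrite big_ord_recr /= -mE; case: (m).
move=> i; rewrite ltnS leq_eqVlt -addnA [n + i]addnC => /predU1P[->|iv];
  rewrite !high.
  have -> : (v == v + n) = false.
    by rewrite -[X in X == _]addn0 eqn_add2l ltn_eqF.
  rewrite !eqxx.
  by rewrite -mE /u /upd /=; split=> //; case: (m).
(* Entries with [i < v] survive: the new addresses have offsets [v] and [v + n], the old ones [i]
   and [i + n], and [v < n]. *)
rewrite eqn_add2r (ltn_eqF iv) (ltn_eqF (ltn_addr n iv)).
rewrite (gtn_eqF (ltn_addl i vn)).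
by have := mem i iv; rewrite -addnA [n + i]addnC /u /upd /= !fr.
Qed.

Definition stored_pair (r : nat -> nat) a := forall i, i < n + n ->
  (r (16 + i) != 0) = if i < n then dominated a i else ~~ dominated a (i - n).

Lemma stored_pairP r a : stored r a n -> stored_pair r a.
Proof.
move=> mem i i2n; case: ltnP => [/mem[]//|ni].
have /mem[_ <-] : i - n < n by lia.
by rewrite -addnA subnKC.
Qed.

(** Here [a] is the first successful candidate: register 4 is 0 in each earlier round, which makes
    the program continue, and positive in round [a]. *)
Lemma run_search a r :
    a < n -> (forall i, i < a -> forall v, v < n -> dominated i v) ->
    (exists2 v, v < n & ~~ dominated a v) ->
    r 0 = n -> r 1 = 1 -> r 2 = 0 ->
  run (1 + a.+1 * (6 + n * (26 + n * 12))) (Config 5 r [::]) (fun c =>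
    [/\ pc c = 50, out c = [::], reg c 0 = n, reg c 1 = 1
      & stored_pair (reg c) a]).
Proof.
move=> an small [v vn av] r0 r1 r2.
pose I i c := [/\ pc c = if i < a.+1 then 6 else 50, out c = [::],
  [/\ reg c 0 = n, reg c 1 = 1, reg c 2 = i & reg c 3 = n.+1 + n * i]
  & a < i -> stored_pair (reg c) a].
apply: (@within_sub _ _ _ _ _ (I a.+1)).
  by move=> c [pcE ? [? ? _ _] mem]; split=> //; rewrite ?pcE ?ltnn //; apply: mem.
run_step; apply: within_loop => [|i c ia].
  by split; rewrite //= r0 r1 muln0 addn0 addn1.
case: c => pc r' o' [/= -> -> [r'0 r'1 r'2 r'3] _]; rewrite ia.
have i_n : i < n by apply: leq_trans an.
have -> : 6 + n * (26 + n * 12) = 3 + n * (26 + n * 12) + 3 by rewrite addnAC.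
apply: within_bind (run_candidate _ i_n r'0 r'1 r'2 r'3) _ => -[pc2 r2' o2].
move=> [/= -> -> [r2'0 r2'1 r2'2 r2'3] r2'4 mem].
do 3 run_step; apply: (@within_run _ _ 0).
split=> //=.
- rewrite -[eqn _ _]/(_ == _) r2'4 sum_nat_eq0 !ltnS.
  case: ltnP => [lt_ia|le_ai].
    by rewrite ifT //; apply/forallP => j; rewrite small.
  have -> : i = a by apply/eqP; rewrite eqn_leq le_ai andbT.
  rewrite ifN //; apply/forallPn; exists (Ordinal vn).
  by rewrite /= av.
- by rewrite r2'0 r2'1 r2'2 r2'3 mulnSr addnA addn1.
rewrite ltnS => le_ai.
have -> : a = i by apply/eqP; rewrite eqn_leq le_ai.
exact: stored_pairP.
Qed.

Lemma run_output a r :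
    r 0 = n -> r 1 = 1 -> stored_pair r a ->
  run (3 + (n + n) * 7) (Config 50 r [::]) (fun c =>
    halted search_prog c /\
    out c = mkseq (dominated a) n ++ mkseq (predC (dominated a)) n).
Proof.
move=> r0 r1 mem.
pose I j c := [/\ pc c = if j < n + n then 53 else 60,
  out c = mkseq (fun i =>
    if i < n then dominated a i else ~~ dominated a (i - n)) j,
  [/\ reg c 1 = 1, reg c 3 = n + n, reg c 5 = j & reg c 12 = 16 + j]
  & stored_pair (reg c) a].
apply: (@within_sub _ _ _ _ _ (I (n + n))).
  move=> [pc r' o] [/= -> -> _ _]; rewrite ltnn; split=> //.
  (* The single output loop of length [2n] is split at [n] into the two vectors. *)
  rewrite {1}/mkseq iotaD map_cat; congr (_ ++ _).
    by apply/eq_in_map => i; rewrite mem_iota add0n => /= ->.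
  rewrite addnC iotaDl -map_comp; apply: eq_map => i /=.
  by rewrite ltnNge leq_addr addKn.
do 3 run_step; apply: within_loop => [|j c jn].
  by split; rewrite //= ?r0 // addn_gt0 n_gt0.
case: c => pc r' o [/= -> -> [r'1 r'3 r'5 r'12] mem']; rewrite jn.
do 7 run_step; apply: (@within_run _ _ 0).
split=> /=.
- by rewrite r'1 r'3 r'5 addn1; apply: back_jump.
- by rewrite mkseqS r'12; congr rcons; exact: mem'.
- by rewrite r'1 r'3 r'5 r'12 !addn1 addnS.
exact: mem'.
Qed.

Lemma search_correct a t :
    100 * n ^ 3 + 100 <= t ->
    a < n -> (forall i, i < a -> forall v, v < n -> dominated i v) ->
    (exists2 v, v < n & ~~ dominated a v) ->
  outputs_within search_prog w t
    (mkseq (dominated a) n ++ mkseq (predC (dominated a)) n).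
Proof.
move=> t_ge an small ex_v.
suff [k kt [h outE]] : run (100 * n ^ 3 + 100) init (fun c =>
    halted search_prog c /\
    out c = mkseq (dominated a) n ++ mkseq (predC (dominated a)) n).
  rewrite /outputs_within -(subnK (leq_trans kt t_ge)) iterD.
  set c := iter k _ _ in h outE *.
  (* A halted configuration is fixed, which turns at most [t] steps into exactly [t]. *)
  have -> : iter (t - k) (step search_prog w) c = c.
    apply: iter_fix; rewrite /step; case: (c) h => pc r o.
    by rewrite /halted; case: fetch.
  by [].
apply: (@within_leq _ _ (1 + n * 4 +
  (1 + a.+1 * (6 + n * (26 + n * 12)) + (3 + (n + n) * 7)))).
  (* With at most [n] rounds the total is at most [12n^3 + 26n^2 + 24n + 5]. *)
  suff : a.+1 * (6 + n * (26 + n * 12)) <= n * (6 + n * (26 + n * 12)) by nia.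
  exact: leq_mul.
apply: within_bind (@run_size [::] _ _ _) _ => // -[pc1 r1 o1] [/= -> -> r10 r11 r12].
apply: within_bind (run_search an small ex_v r10 r11 r12) _ => -[pc2 r2 o2].
by move=> [/= -> -> r20 r21 mem]; apply: run_output.
Qed.

End Search.

(** * From vertex indices back to graphs and their encodings *)

Section Encoding.
Variables (G : sgraph) (x0 : G).

Let ith i := nth x0 (enum G) i.
Let adj : rel nat := fun i j => edge (ith i) (ith j).

Lemma ith_enum_rank x : ith (enum_rank x) = x.
Proof. by rewrite /ith -enum_val_nth enum_rankK. Qed.

Lemma size_encode_graph :
  size (encode_graph G) = #|G| + (#|G| * #|G|).+1.
Proof. by rewrite size_cat size_nseq /= size_allpairs -cardE. Qed.

Lemma nth_encode_graph_unary i : i <= #|G| ->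
  nth false (encode_graph G) i = (i < #|G|).
Proof.
rewrite nth_cat size_nseq leq_eqVlt => /predU1P[->|iG].
  by rewrite ltnn subnn.
by rewrite iG nth_nseq iG.
Qed.

Lemma nth_allpairs (S T R : Type) (f : S -> T -> R) y0 z0 r0
    (s : seq S) (t : seq T) i j :
    i < size s -> j < size t ->
  nth r0 [seq f y z | y <- s, z <- t] (size t * i + j) =
    f (nth y0 s i) (nth z0 t j).
Proof.
elim: s i => //= y s IHs [|i] i_s j_t; rewrite nth_cat size_map.
  by rewrite muln0 add0n j_t (nth_map z0).
by rewrite mulnS -addnA ltnNge leq_addr /= addKn IHs.
Qed.

Lemma nth_encode_graph_edge i j : i < #|G| -> j < #|G| ->
  nth false (encode_graph G) (#|G|.+1 + #|G| * i + j) = adj i j.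
Proof.
(* The offset [#|G|.+1] skips the unary prefix and its separator. *)
move=> iG jG; rewrite nth_cat size_nseq ifN; last by rewrite -leqNgt; lia.
rewrite -addnA addSnnS addKn /= cardE.
by rewrite (nth_allpairs _ x0 x0) -?cardE.
Qed.

Lemma dominated_dom_set a v : a < #|G| -> v < #|G| ->
  dominated #|G| adj a v = (ith v \in dom_set (ith a)).
Proof.
move=> aG vG; rewrite inE /dominated -/(adj v a).
have -> : (ith v == ith a) = (v == a).
  by rewrite /ith nth_uniq ?enum_uniq // -cardE.
congr [|| _, _ | _ && _]; apply/idP/idP.
- by move=> /forallP h; apply/forallP => x; have := h (enum_rank x);
    rewrite /adj ith_enum_rank.
- by move=> /forallP h; apply/forallP => c; apply: h.
- by case/existsP => c h; apply/existsP; exists (ith c).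
by case/existsP => x h; apply/existsP; exists (enum_rank x);
  rewrite /adj ith_enum_rank.
Qed.

Lemma encode_setE (S : {set G}) (f : pred nat) :
    (forall i, i < #|G| -> f i = (ith i \in S)) ->
  encode_set S = mkseq f #|G|.
Proof.
move=> fE; rewrite /encode_set -{1}[enum G](mkseq_nth x0) -map_comp -cardE.
by apply/eq_in_map => i; rewrite mem_iota /= add0n => /fE.
Qed.

End Encoding.

(** * The characterization and the polynomial-time search *)

Theorem theorem6 :
  (forall G : sgraph, bipartite G ->
     ((exists V1 V2 : {set G}, dconvex_2partition V1 V2)
      <-> at_least 3 (diameter G)))
  /\
  poly_time_search
    (fun G : sgraph => bipartite G /\
       exists V1 V2 : {set G}, dconvex_2partition V1 V2)
    (fun (G : sgraph) (V1 V2 : {set G}) => dconvex_2partition V1 V2).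
Proof.
split=> [G|]; first exact: dconvex_2partition_diameter.
exists search_prog, 100, 3 => G [bip [V1 [V2]]].
case/dconvex_2partition_disjoint => x0 [y0 /dom_setPn y0S].
pose dom := dominated #|G| (fun i j =>
  edge (nth x0 (enum G) i) (nth x0 (enum G) j)).
have domE a v : a < #|G| -> v < #|G| ->
    dom a v = (nth x0 (enum G) v \in dom_set (nth x0 (enum G) a)).
  exact: dominated_dom_set.
(* The promised partition makes some candidate succeed; the least such index is where the program
   stops. *)
have exP : exists a, (a < #|G|) && [exists v : 'I_#|G|, ~~ dom a v].
  exists (enum_rank x0); rewrite ltn_ord; apply/existsP; exists (enum_rank y0).
  by rewrite domE // !ith_enum_rank.
case: (ex_minnP exP) => a /andP[aG /existsP[v av]] a_min.
set x := nth x0 (enum G) a.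
exists (dom_set x), (~: dom_set x); split.
  by apply: (@dom_set_partition _ _ (nth x0 (enum G) v)) => //; rewrite -domE.
have -> : encode_pair (dom_set x) (~: dom_set x) =
    mkseq (dom a) #|G| ++ mkseq (predC (dom a)) #|G|.
  by congr (_ ++ _); apply: (encode_setE (x0 := x0)) => i iG;
    rewrite /= domE ?in_setC.
apply: search_correct => //.
- by apply/card_gt0P; exists x0.
- exact: nth_encode_graph_unary.
- exact: nth_encode_graph_edge.
(* The cubic bound in [#|G|] transfers since the input has length at least [#|G|]. *)
- rewrite leq_add2r leq_mul2l /= leq_exp2r // size_encode_graph.
  exact: leq_addr.
- move=> i ia u uG; apply: contraLR ia => domF; rewrite -leqNgt.
  have [iG|/(leq_trans (ltnW aG))//] := ltnP i #|G|.
  by rewrite a_min // iG; apply/existsP; exists (Ordinal uG).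
by exists v.
Qed.
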